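(* If $L$ is a non-split classical link, then $g_{alt}(L)\leq g_T(L)$, where $g_{alt}(L)$ is the alternating genus and $g_T(L)$ the Turaev genus of $L$.
   Context: Turaev genus. For a connected classical link diagram $D$ with $c(D)$ crossings let $s_0(D)$, $s_1(D)$ be the all $0$- and all $1$-smoothing states, and $|s|$ the number of cycles of a state $s$. (The $0$-smoothing of a crossing merges the two local regions swept out when the over-strand is rotated counterclockwise to the under-strand; the $1$-smoothing is the other one.) Set $g_T(D)=\frac12\bigl(c(D)+2-|s_0(D)|-|s_1(D)|\bigr)$; for a non-split classical link $L$, $g_T(L)$ is the minimum of $g_T(D)$ over all connected classical diagrams $D$ of $L$. Virtual diagrams and surfaces. A virtual link diagram $D$ is a generic collection of immersed closed curves in the plane whose double points are marked as classical (with over/under information) or virtual; virtual links are such diagrams up to generalized Reidemeister moves, and classical links are regarded as virtual links. Let $S_D$ be the compact oriented surface obtained from disks around the classical crossings by attaching bands along the arcs of $D$ (at virtual crossings the bands pass each other disjointly; a component without classical crossings gives an annulus). It carries a diagram $\widetilde D$ corresponding to $D$, without virtual crossings. The supporting genus of $D$ is the minimal genus of a closed connected oriented surface into which $S_D$ embeds preserving orientation; if $S_D$ is connected it is the genus of the surface obtained by capping the boundary circles of $S_D$ with disks. Alternating genus. A checkerboard coloring of $D$ is a black/white coloring of the regions of $S_D\smallsetminus\widetilde D$ such that regions on the two sides of each edge of $\widetilde D$ have different colors; a diagram admitting one is called a checkerboard diagram. At a classical crossing $c$ the incidence number is $\eta(c)=+1$ if the two local regions swept out when the over-strand is rotated counterclockwise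 (with respect to the orientation of the surface) to the under-strand are black, and $\eta(c)=-1$ if they are white. The operation or (orientation reversal) at a crossing reverses the direction of the corresponding arrow of the Gauss diagram and keeps the sign of the crossing. For a checkerboard colored diagram $D$, let $D_{alt}$ be the diagram obtained by applying or to all crossings with $\eta=-1$; it is an alternating virtual link diagram. The alternating genus of a non-split checkerboard colorable virtual link $K$ is $$g_{alt}(K)=\min\{g(D_{alt})\mid D\text{ is a checkerboard (virtual) diagram for }K\},$$ where $g(D_{alt})$ is the supporting genus of $D_{alt}$. *)

(* Defs.v *)
From HB Require Import structures.
From mathcomp Require Import all_boot all_order fingroup perm all_algebra.
From mathcomp Require Import zify.
From Stdlib Require Relation_Operators.

Set Implicit Arguments.
Unset Strict Implicit.
Unset Printing Implicit Defensive.

Import Order.TTheory GRing.Theory Num.Theory.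
Local Open Scope ring_scope.

(** * Oriented link diagrams as combinatorial objects

  An oriented, generic, immersed family of closed curves on an oriented surface
  passes twice through each double point.  The elements of [passage] are these
  passages: [mate x] is the other passage through the same double point,
  [next x] is the passage that follows [x] along the curve, and [side x] tells
  whether the curve through [mate x] crosses the one through [x] from right to
  left.  [circles] counts the components without double points.  The relative
  position of the connected components in the plane is not recorded: it changes
  neither the link, nor [S_D], nor the state circles. *)

Variant passage_kind := Over | Under | Virtual.

Definition kind_eqb (k l : passage_kind) : bool :=
  match k, l with
  | Over, Over | Under, Under | Virtual, Virtual => true
  | _, _ => false
  end.

Lemma kind_eqP : Equality.axiom kind_eqb.
Proof. by case; case; constructor. Qed.
HB.instance Definition _ := hasDecEq.Build passage_kind kind_eqP.

Definition opposite_kind (k : passage_kind) : passage_kind :=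
  match k with Over => Under | Under => Over | Virtual => Virtual end.

Lemma opposite_kindK : involutive opposite_kind.
Proof. by case. Qed.

Record diagram := Diagram {
  passage : finType;
  next : {perm passage};
  mate : passage -> passage;
  side : passage -> bool;
  kind : passage -> passage_kind;
  circles : nat;
  mateK : involutive mate;
  mate_neq : forall x, mate x != x;
  side_mate : forall x, side (mate x) = ~~ side x;
  kind_mate : forall x, kind (mate x) = opposite_kind (kind x) }.

Definition crossings (D : diagram) : nat := (#|passage D|./2)%N.

(** ** The 4-valent graph and its ribbon surface

  [(x, false)] is the half-edge entering the passage [x], [(x, true)] the one
  leaving it.  If [side x] holds, the half-edges at the double point of [x] are,
  counterclockwise:
    [(x, false); (mate x, false); (x, true); (mate x, true)]. *)

Definition dart (D : diagram) : finType := (passage D * bool)%type.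

Definition ccw (D : diagram) (d : dart D) : dart D :=
  (mate d.1, d.2 == side d.1).

Definition cw (D : diagram) (d : dart D) : dart D :=
  (mate d.1, d.2 (+) side d.1).

Lemma ccwK (D : diagram) : cancel (@ccw D) (@cw D).
Proof.
by case=> x b; rewrite /cw /ccw /= mateK side_mate; case: b; case: (side x).
Qed.

Lemma cwK (D : diagram) : cancel (@cw D) (@ccw D).
Proof.
by case=> x b; rewrite /cw /ccw /= mateK side_mate; case: b; case: (side x).
Qed.

Definition other_end (D : diagram) (d : dart D) : dart D :=
  if d.2 then (next D d.1, false) else (((next D)^-1)%g d.1, true).

Lemma other_endK (D : diagram) : involutive (@other_end D).
Proof. by case=> x [] /=; rewrite /other_end /= ?permK ?permKV. Qed.

(** The dart [d] also stands for the local region (corner) between [d] and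
  [ccw d], which lies to the left of the edge that leaves along [d].  The next
  corner along the boundary of the same region is [face d]. *)

Definition face (D : diagram) (d : dart D) : dart D := cw (other_end d).

(** Boundary circles of the ribbon surface; a crossing-free component
  contributes an annulus. *)
Definition boundaries (D : diagram) : nat :=
  (fcard (@face D) predT + (circles D).*2)%N.

(** Disks at the double points together with bands, resp. annuli. *)
Definition atom (D : diagram) : finType := (passage D + 'I_(circles D))%type.

Definition atom_adj (D : diagram) (a b : atom D) : bool :=
  match a, b with
  | inl x, inl y => [|| y == mate x, y == next D x | x == next D y]
  | _, _ => false
  end.

Definition components (D : diagram) : nat := n_comp (@atom_adj D) predT.

Definition connected (D : diagram) : Prop := components D = 1%N.

(** The disks minus the bands, one band for each passage. *)
Definition ribbon_euler (D : diagram) : int :=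
  (crossings D)%:Z - #|passage D|%:Z.

(** Capping the boundary circles yields only spheres. *)
Definition planar (D : diagram) : Prop :=
  ribbon_euler D + (boundaries D)%:Z = (components D)%:Z *+ 2.

Definition is_classical (D : diagram) : Prop := forall x, kind (d := D) x != Virtual.

(** A virtual diagram is a plane curve; virtual double points are vertices of
  the plane graph too. *)
Record virtual_diagram := VirtualDiagram {
  vdiagram :> diagram;
  vdiagram_planar : planar vdiagram }.

Record classical_diagram := ClassicalDiagram {
  cdiagram :> virtual_diagram;
  cdiagram_classical : is_classical cdiagram }.

(** ** Forgetting double points *)

Section Erase.
Variables (D : diagram) (A : pred (passage D)).

Definition kept (x : passage D) : bool := ~~ A x && ~~ A (mate x).

Definition kept_passage : finType := {x : passage D | kept x}.

Lemma kept_mate x : kept (mate x) = kept x.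
Proof. by rewrite /kept mateK andbC. Qed.

(** The number of erased passages right after [x]. *)
Definition erased_run (x : passage D) : nat :=
  find kept (fingraph.orbit (next D) (next D x)).

Definition kept_next (x : passage D) : passage D :=
  iter (erased_run x) (next D) (next D x).

Lemma erased_run_lt x :
  kept x -> (erased_run x < fingraph.order (next D) (next D x))%N.
Proof.
move=> kx; rewrite -size_orbit -has_find; apply/hasP; exists x => //.
by rewrite -fconnect_orbit (fconnect_sym (@perm_inj _ _)) fconnect1.
Qed.

Lemma kept_nextP x : kept x -> kept (kept_next x).
Proof.
move=> kx; have lt := erased_run_lt kx.
have h : has kept (fingraph.orbit (next D) (next D x)).
  by rewrite has_find size_orbit.
by have := nth_find (next D x) h; rewrite /fingraph.orbit nth_traject.
Qed.

Lemma erased_runP x i :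
  kept x -> (i < erased_run x)%N -> ~~ kept (iter i (next D) (next D x)).
Proof.
move=> kx lt; have := before_find (next D x) lt.
by rewrite /fingraph.orbit nth_traject => [->//|]; apply: ltn_trans (erased_run_lt kx).
Qed.

Lemma kept_next_inj : {in kept &, injective kept_next}.
Proof.
have iter_inj n : injective (iter n (next D)).
  by elim: n => [|n IH] a b //= /perm_inj /IH.
suff H x y : kept x -> kept y -> (erased_run x <= erased_run y)%N ->
    kept_next x = kept_next y -> x = y.
  move=> x y kx ky E; case/orP: (leq_total (erased_run x) (erased_run y)) => le.
    exact: H.
  by apply/esym/H.
move=> kx ky le; rewrite /kept_next -!iterSr -(subnKC le) -addSn iterD.
move/iter_inj; case E: (_ - _)%N => [|k] //= xE.
have /(erased_runP ky) : (k < erased_run y)%N by rewrite -E in le *; lia.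
by rewrite -iterSr /= -xE kx.
Qed.

Definition kept_next_sub (x : kept_passage) : kept_passage :=
  exist _ (kept_next (val x)) (kept_nextP (valP x)).

Lemma kept_next_sub_inj : injective kept_next_sub.
Proof.
move=> x y /(congr1 val) /= E.
by apply/val_inj/kept_next_inj => //; apply: valP.
Qed.

Definition kept_mate_sub (x : kept_passage) : kept_passage :=
  exist _ (mate (val x)) (etrans (kept_mate (val x)) (valP x)).

Lemma kept_mate_subK : involutive kept_mate_sub.
Proof. by move=> x; apply/val_inj/mateK. Qed.

Lemma kept_mate_sub_neq x : kept_mate_sub x != x.
Proof. by rewrite -val_eqE mate_neq. Qed.

(** Forget the double points one of whose passages is in [A]; the curves
  through them are prolonged, and a component losing all its double points
  becomes crossing-free. *)
Definition erase : diagram := {|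
  passage := kept_passage;
  next := perm kept_next_sub_inj;
  mate := kept_mate_sub;
  side := fun x => side (val x);
  kind := fun x => kind (val x);
  circles := (circles D
    + #|[set C in porbits (next D) | [forall x in C, ~~ kept x]]|)%N;
  mateK := kept_mate_subK;
  mate_neq := kept_mate_sub_neq;
  side_mate := fun x => side_mate (val x);
  kind_mate := fun x => kind_mate (val x) |}.

End Erase.

(** The diagram without virtual crossings on [S_D].  It is the Gauss diagram of
  [D], with an arrow from [x] to [mate x] for each [x] of kind [Over], and
  [S_D] is its ribbon surface. *)
Definition tilde (D : diagram) : diagram :=
  erase [pred x : passage D | kind x == Virtual].

(** ** Generalized Reidemeister moves *)

(** Equality of diagrams up to orientation preserving homeomorphism. *)
Definition diagram_iso (D E : diagram) : Prop :=
  circles D = circles E /\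
  exists f : passage D -> passage E,
    [/\ bijective f,
        forall x, f (next D x) = next E (f x),
        forall x, f (mate x) = mate (f x),
        forall x, side (f x) = side x
      & forall x, kind (f x) = kind x].

Definition same_crossing (D : diagram) (x y : passage D) : bool :=
  (y == x) || (y == mate x).

(** The edge leaving along [d] joins the passages [d.1] and [far d]. *)
Definition far (D : diagram) (d : dart D) : passage D := (other_end d).1.

(** The edge leaving along [d] bounds a monogon. *)
Definition monogon (D : diagram) (d : dart D) : Prop := face d = d.

(** [d] runs along one of the two sides of a bigon, and the strand on this side
  is over (under, virtual) at both corners. *)
Definition bigon (D : diagram) (d : dart D) : Prop :=
  [/\ face (face d) = d,
      ~~ same_crossing d.1 (face d).1
    & kind d.1 = kind (far d)].

(** [d] runs along one of the three sides of a triangle.  The strand on this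
  side is either over at both of its corners, the third one being classical,
  or virtual at both of them, the third one being arbitrary. *)
Definition triangle (D : diagram) (d : dart D) : Prop :=
  [/\ face (face (face d)) = d,
      [&& ~~ same_crossing d.1 (face d).1,
          ~~ same_crossing d.1 (face (face d)).1
        & ~~ same_crossing (face d).1 (face (face d)).1],
      kind d.1 = kind (far d)
    & kind d.1 = Virtual \/
      (kind d.1 = Over /\ kind (face (face d)).1 != Virtual)].

(** Conjugating [next] by a product of disjoint transpositions of consecutive
  passages exchanges the order in which the curve meets them. *)
Definition renext (D : diagram) (t : {perm passage D}) : diagram := {|
  passage := passage D;
  next := (next D ^ t)%g;
  mate := @mate D;
  side := @side D;
  kind := @kind D;
  circles := circles D;
  mateK := @mateK D;
  mate_neq := @mate_neq D;
  side_mate := @side_mate D;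
  kind_mate := @kind_mate D |}.

Definition triangle_perm (D : diagram) (d : dart D) : {perm passage D} :=
  (tperm d.1 (far d)
   * tperm (face d).1 (far (face d))
   * tperm (face (face d)).1 (far (face (face d))))%g.

(** [R1], [R2] cover the classical and the purely virtual moves; [R3] covers
  the classical, the purely virtual and the mixed one.  Between diagrams without
  virtual crossings these are the classical Reidemeister moves. *)
Inductive move (D E : diagram) : Prop :=
| Iso of diagram_iso D E
| R1 d of monogon (D := D) d & diagram_iso (erase (pred1 d.1)) E
| R2 d of bigon (D := D) d & diagram_iso (erase (pred2 d.1 (far d))) E
| R3 d of triangle (D := D) d & diagram_iso (renext (triangle_perm d)) E.

(** Links are equivalence classes of diagrams. *)
Definition virtual_equiv : virtual_diagram -> virtual_diagram -> Prop :=
  Relation_Operators.clos_refl_sym_trans virtual_diagram (fun D E => move D E).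

Definition classical_equiv : classical_diagram -> classical_diagram -> Prop :=
  Relation_Operators.clos_refl_sym_trans classical_diagram (fun D E => move D E).

Definition non_split (L : classical_diagram) : Prop :=
  forall D : classical_diagram, classical_equiv D L -> connected D.

Definition is_minimum (disp : Order.disp_t) (T : porderType disp)
    (P : T -> Prop) (m : T) : Prop :=
  P m /\ forall n, P n -> (m <= n)%O.

(** ** Turaev genus *)

(** A state [s] chooses the [s x]-smoothing at the crossing of [x].  The regions
  swept out when the over-strand is rotated counterclockwise to the under-strand
  are the corners [(x, b)] with [kind x = Over].  Merging them reconnects such a
  half-edge with its clockwise neighbor, merging the other two reconnects it with
  its counterclockwise neighbor. *)
Definition state (D : diagram) := {s : passage D -> bool | forall x, s (mate x) = s x}.

Definition reconnect (D : diagram) (s : state D) (d : dart D) : dart D :=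
  if sval s d.1 == (kind d.1 == Over) then ccw d else cw d.

Definition state_adj (D : diagram) (s : state D) (d e : dart D) : bool :=
  (e == other_end d) || (e == reconnect s d).

Definition cycles (D : diagram) (s : state D) : nat :=
  (n_comp (state_adj s) predT + circles D)%N.

Definition const_state (D : diagram) (b : bool) : state D :=
  exist (fun s : passage D -> bool => forall x, s (mate x) = s x)
    (fun=> b) (fun=> erefl b).

Definition diagram_turaev_genus (D : diagram) : rat :=
  ((crossings D)%:R + 2%:R - (cycles (const_state D false))%:R
   - (cycles (const_state D true))%:R) / 2%:R.

Definition turaev_genus (L : classical_diagram) (q : rat) : Prop :=
  is_minimum (fun r => exists D : classical_diagram,
    [/\ classical_equiv D L, connected D & r = diagram_turaev_genus D]) q.

(** ** Supporting genus *)

Section Closing.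
Variable D : diagram.

(** The complement of an embedded copy of the ribbon surface in a closed
  surface consists of pieces: compact connected oriented surfaces with boundary.
  [dp] and [cp] tell which piece is glued along the boundary circle through the
  corner [d], resp. along a side of a crossing-free component. *)
Definition glue_adj (piece : finType) (dp : dart D -> piece)
    (cp : 'I_(circles D) * bool -> piece) (a b : atom D + piece) : bool :=
  match a, b with
  | inl a, inl b => atom_adj a b
  | inl (inl x), inr p | inr p, inl (inl x) =>
      (dp (x, false) == p) || (dp (x, true) == p)
  | inl (inr i), inr p | inr p, inl (inr i) =>
      (cp (i, false) == p) || (cp (i, true) == p)
  | inr _, inr _ => false
  end.

Record closing := Closing {
  piece : finType;
  piece_genus : piece -> nat;
  dart_piece : dart D -> piece;
  circle_piece : 'I_(circles D) * bool -> piece;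
  dart_piece_face : forall d, dart_piece (face d) = dart_piece d;
  closing_connected :
    n_comp (glue_adj dart_piece circle_piece) predT = 1%N }.

(** A piece of genus [h] with [b] boundary circles has Euler characteristic
  [2 - 2h - b]; each boundary circle of the ribbon surface is one of exactly one
  piece. *)
Definition closing_euler (c : closing) : int :=
  ribbon_euler D
  + \sum_(p : piece c) (2%:Z - (piece_genus p)%:Z *+ 2)
  - (boundaries D)%:Z.

End Closing.

(** The ribbon surface of [G] is [S_D] when [G] is the Gauss diagram of [D]. *)
Definition supporting_genus (G : diagram) (g : nat) : Prop :=
  is_minimum (fun h : nat =>
    exists c : closing G, closing_euler c = 2%:Z - h%:Z *+ 2) g.

(** ** Alternating genus *)

(** The regions of the ribbon surface minus the curves are collars of its
  boundary circles; [col d] is true when the region of the corner [d] is black.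
  The two collars along a crossing-free component can always be given different
  colors, and play no role afterwards. *)
Definition checkerboard_coloring (G : diagram) (col : dart G -> bool) : Prop :=
  (forall d, col (face d) = col d) /\
  (forall d, col (other_end d) = ~~ col d).

Definition over_passage (G : diagram) (x : passage G) : passage G :=
  if kind x == Over then x else mate x.

(** Of the two swept corners one is enough, by [coloring_opposite]. *)
Definition incidence (G : diagram) (col : dart G -> bool) (x : passage G) : int :=
  if col (over_passage x, true) then 1 else -1.

Lemma coloring_opposite (G : diagram) (col : dart G -> bool) (x : passage G) :
  checkerboard_coloring col -> col (x, false) = col (x, true).
Proof.
case=> cf co.
have ccwN d : col (cw d) = ~~ col d.
  by have := cf (other_end d); rewrite /face other_endK co => ->.
suff -> : (x, false) = cw (cw (x, true)) by rewrite !ccwN negbK.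
by rewrite /cw /= mateK side_mate; case: (side x).
Qed.

(** [true] for a positive crossing. *)
Definition crossing_sign (G : diagram) (x : passage G) : bool :=
  side x (+) (kind x == Under).

Section OrientationReversal.
Variables (G : diagram) (A : pred (passage G)).

Definition or_kind (x : passage G) : passage_kind :=
  if A x || A (mate x) then opposite_kind (kind x) else kind x.

(** The side determined by the new arrow and the old sign. *)
Definition or_side (x : passage G) : bool :=
  crossing_sign x (+) (or_kind x == Under).

Lemma or_kind_mate x : or_kind (mate x) = opposite_kind (or_kind x).
Proof. by rewrite /or_kind mateK orbC kind_mate; case: ifP. Qed.

Lemma or_side_mate x : or_side (mate x) = ~~ or_side x.
Proof.
rewrite /or_side /crossing_sign or_kind_mate side_mate kind_mate /or_kind.
by case: ifP; case: (kind x); case: (side x).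
Qed.

(** Reverse the arrows of the crossings one of whose passages is in [A], keeping
  their signs. *)
Definition orientation_reversal : diagram := {|
  passage := passage G;
  next := next G;
  mate := @mate G;
  side := or_side;
  kind := or_kind;
  circles := circles G;
  mateK := @mateK G;
  mate_neq := @mate_neq G;
  side_mate := or_side_mate;
  kind_mate := or_kind_mate |}.

Lemma or_sign (x : passage G) :
  crossing_sign (G := orientation_reversal) x = crossing_sign x.
Proof. by rewrite {1}/crossing_sign /= /or_side addbK. Qed.

End OrientationReversal.

Definition alt (G : diagram) (col : dart G -> bool) : diagram :=
  orientation_reversal [pred x : passage G | incidence col x == -1].

Definition alternating_genus (K : virtual_diagram) (g : nat) : Prop :=
  is_minimum (fun h : nat =>
    exists D : virtual_diagram, virtual_equiv D K /\
    exists col : dart (tilde D) -> bool,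
      checkerboard_coloring col /\ supporting_genus (alt col) h) g.

(* Main.v *)
(** Let [D] be a connected classical diagram realizing the Turaev genus of [L].
  Being planar, it has a checkerboard coloring.  In [D_alt], reversing the arrows
  of the crossings with [eta = -1] turns the cyclic order around these crossings,
  so that walking along a boundary circle of the ribbon surface of [D_alt] amounts
  to walking in [D] along an edge and then turning at the crossing as in the
  [0]- or in the [1]-smoothing, according to the color on the left, which never
  changes.  Hence the boundary circles of [D_alt] are the cycles of the two
  constant states of [D], and the genus of the closed surface of [D_alt] is
  [g_T(D)].

  The coloring comes from linear algebra over [F_2].  The set of all edges is a
  cycle, the vertices being 4-valent; the boundary map of the faces has rank at
  least [F - 1], that of the edges at least [V - 1], and they compose to [0].
  Hence [V - E + F <= 2] on every closed connected surface, and in the planar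
  case the set of all edges is the boundary of a set of faces. *)

From mathcomp Require Import all_boot all_order fingroup perm all_algebra.
From mathcomp Require Import zify ring.
From Stdlib Require Import Classical.
Require Import Defs.

Set Implicit Arguments.
Unset Strict Implicit.
Unset Printing Implicit Defensive.

Import Order.TTheory GRing.Theory Num.Theory.
Local Open Scope ring_scope.

(** * Counting the components of a relation *)

Lemma connect_sym_of_sym (T : finType) (e : rel T) : symmetric e -> connect_sym e.
Proof.
by move=> es x y; rewrite connect_rev; apply: eq_connect => a b; rewrite /= es.
Qed.

Lemma n_comp_bij (T T' : finType) (h : T' -> T) (g : T -> T') (e : rel T) (e' : rel T') :
  connect_sym e -> connect_sym e' -> cancel h g -> cancel g h ->
  (forall x y, e (h x) (h y) = e' x y) ->
  n_comp e predT = n_comp e' predT.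
Proof.
move=> es es' hK gK he; rewrite (adjunction_n_comp h es es') //.
split=> [x _|x y _]; first by exists (g x); rewrite gK.
apply/idP/idP => [cxy|].
  (* The points whose image is connected to [h x] form a set closed under [e']. *)
  have := @closed_connect _ e' [pred z | connect e (h x) (h z)] _ x y cxy.
  rewrite !inE connect0 => <- // z w; rewrite -he => zw; rewrite !inE.
  exact/(same_connect1r es).
move=> cxy.
have := @closed_connect _ e [pred z | connect e' x (g z)] _ _ _ cxy.
rewrite !inE !hK connect0 => <- // z w zw; rewrite !inE.
by apply/(same_connect1r es'); rewrite -he !gK.
Qed.

Lemma n_comp1_connect (T : finType) (e : rel T) :
  symmetric e -> n_comp e predT = 1%N -> forall x y, connect e x y.
Proof.
move=> /connect_sym_of_sym es /eqP; rewrite /n_comp_mem => /card1P[r rP] x y.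
have rr z : fingraph.root e z = r.
  by apply/eqP; have := rP (fingraph.root e z); rewrite !inE (roots_root es) => <-.
by rewrite -(root_connect es) !rr.
Qed.

Lemma connect_n_comp1 (T : finType) (e : rel T) (x : T) :
  symmetric e -> (forall y, connect e x y) -> n_comp e predT = 1%N.
Proof.
move=> es cx; rewrite -(n_comp_connect (connect_sym_of_sym es) x).
by apply: eq_n_comp_r => y; rewrite !inE; apply/esym/cx.
Qed.

(* Each orbit of the dihedral group generated by [e] and [r] meets [c] in one
  cycle of [r \o e]. *)
Lemma n_comp_two_involutions (T : finType) (e r f : T -> T) (c : pred T) :
  involutive e -> involutive r -> injective f ->
  (forall x, c (e x) = ~~ c x) -> (forall x, c (r x) = ~~ c x) ->
  (forall x, c (f x) = c x) -> (forall x, c x -> f x = r (e x)) ->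
  n_comp (fun x y => (y == e x) || (y == r x)) predT = fcard f c.
Proof.
move=> eK rK fI ce cr cf fE.
(* [h] retracts all points onto [c] along [e]; by adjunction, components of [adj] correspond to
   cycles of [f] inside [c]. *)
pose h x := if c x then x else e x.
set adj := fun x y : T => _.
have as_ : symmetric adj.
  move=> x y; rewrite /adj.
  by congr (_ || _); apply/eqP/eqP => ->; rewrite ?eK ?rK.
have acs := connect_sym_of_sym as_.
have ch x : c (h x) by rewrite /h; case: ifP => // cx; rewrite ce cx.
have ax x : connect adj x (h x).
  rewrite /h; case: ifP => // cx; apply: connect1; by rewrite /adj eqxx.
rewrite (@adjunction_n_comp _ _ h (frel f) adj (fconnect_sym fI) acs c).
- by apply: eq_n_comp_r => x; rewrite -[RHS]/(c (h x)) ch.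
- by move=> x y /eqP <-; rewrite -!topredE /= cf.
split=> [x cx|x y _].
  by exists x; rewrite /h [c x]cx.
(* After retraction, an [r]-step into [c] is one step of [f]; an [r]-step out of [c] is the same
   step backwards. *)
have fr z : c (r z) -> h (r z) = f (h z).
  rewrite cr => /negbTE cz; rewrite /h cr cz /=.
  by rewrite fE ?eK // ce cz.
apply/idP/idP => cxy.
  have := @closed_connect _ adj [pred z | fconnect f (h x) (h z)] _ x y cxy.
  rewrite !inE connect0 => <- // z w /orP[]/eqP->; rewrite !inE.
    by congr (fconnect f _ _); rewrite {2}/h ce /h; case: ifP; rewrite ?eK.
  case: (boolP (c z)) => cz; last by rewrite fr ?cr // -same_fconnect1_r.
  by rewrite -{1}[z]rK fr ?rK // -same_fconnect1_r.
rewrite (same_connect acs (ax x)) (same_connect_r acs (ax y)).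
apply: etrans (connect0 adj (h x)).
(* Membership in [c] is carried along because [f] is known to be [r \o e] only there. *)
suff /(_ (h x) (h y) cxy) : forall z w, fconnect f z w ->
    c z && connect adj (h x) z = c w && connect adj (h x) w.
  by rewrite !ch.
move=> z w; apply: (@fconnect_invariant _ f _ (fun z => c z && connect adj (h x) z)).
move=> {}z /=; rewrite cf; case: (boolP (c z)) => //= cz.
rewrite fE // -(same_connect1r acs (x := e z)) ?/adj ?eqxx ?orbT //.
by rewrite -(same_connect1r acs (x := z)) ?/adj ?eqxx.
Qed.

(** * Invariance under isomorphism *)

Section Darts.
Variable D : diagram.
Implicit Types d : dart D.

Lemma face_inj : injective (@face D).
Proof. by move=> d d' /(can_inj (@cwK D)) /(can_inj (@other_endK D)). Qed.

Lemma face_other_end d : face (other_end d) = cw d.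
Proof. by rewrite /face other_endK. Qed.

Lemma cw_cw d : cw (cw d) = (d.1, ~~ d.2).
Proof. by case: d => x b; rewrite /cw /= mateK side_mate addbN addbK. Qed.

Lemma atom_adj_sym : symmetric (@atom_adj D).
Proof.
case=> [x|i] [y|j] //=; rewrite [_ || (y == _)]orbC; congr (_ || _).
by apply/eqP/eqP => ->; rewrite mateK.
Qed.

End Darts.

Section Iso.
Variables D E : diagram.
Hypothesis isoDE : diagram_iso D E.

Lemma iso_components : components D = components E.
Proof.
have [ec [f [[g fK gK] fn fm _ _]]] := isoDE.
pose h (a : atom D) : atom E :=
  match a with inl x => inl (f x) | inr i => inr (cast_ord ec i) end.
pose k (a : atom E) : atom D :=
  match a with inl x => inl (g x) | inr i => inr (cast_ord (esym ec) i) end.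
apply/esym/(@n_comp_bij _ _ h k); try exact/connect_sym_of_sym/atom_adj_sym.
- by case=> [x|i] /=; rewrite ?fK ?cast_ordK.
- by case=> [x|i] /=; rewrite ?gK ?cast_ordKV.
by case=> [x|i] [y|j] //=; rewrite -fm -!fn !(inj_eq (can_inj fK)).
Qed.

Lemma iso_card : #|passage D| = #|passage E|.
Proof. by have [_ [f [fb _ _ _ _]]] := isoDE; apply: bij_eq_card fb. Qed.

Lemma iso_darts : exists (f : dart D -> dart E) (g : dart E -> dart D),
  [/\ cancel f g, cancel g f, {morph f : d / other_end d},
      {morph f : d / ccw d} /\ {morph f : d / cw d}
    & forall d, kind (f d).1 = kind d.1].
Proof.
have [ec [f [[g fK gK] fn fm fs fk]]] := isoDE.
exists (fun d => (f d.1, d.2)), (fun d => (g d.1, d.2)); split=> //.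
- by case=> x b /=; rewrite fK.
- by case=> x b /=; rewrite gK.
- case=> x [] /=; rewrite /other_end /= ?fn //; congr (_, _).
  by apply/(canRL (permK _)); rewrite -fn permKV.
- by split; case=> x b; rewrite /ccw /cw /= fm fs.
- by move=> d; apply: fk.
Qed.

Lemma iso_boundaries : boundaries D = boundaries E.
Proof.
have [f [g [fK gK fo [_ fc] _]]] := iso_darts.
rewrite /boundaries (proj1 isoDE); congr (_ + _)%N; apply/esym.
apply: (@n_comp_bij _ _ f g) => //; try exact/fconnect_sym/face_inj.
by move=> d d'; rewrite /= /face -fo -fc (inj_eq (can_inj fK)).
Qed.

Lemma iso_planar : planar D <-> planar E.
Proof.
by rewrite /planar iso_boundaries iso_components /ribbon_euler /crossings iso_card.
Qed.

Lemma iso_classical : is_classical D <-> is_classical E.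
Proof.
have [ec [f [[g fK gK] fn fm fs fk]]] := isoDE.
by split=> cl x; [rewrite -(gK x) fk|rewrite -fk]; apply: cl.
Qed.

End Iso.

(** * Smoothings, and diagrams without virtual crossings *)

(** The two passages of a classical crossing turn in opposite directions, so a second turn undoes
    the first; at a virtual double point both would turn the same way. *)
Lemma reconnectK (D : diagram) (s : state D) :
  is_classical D -> involutive (reconnect s).
Proof.
move=> cl d; rewrite {2}/reconnect; have := cl d.1; have := kind_mate d.1.
case: ifP => E kE k; rewrite /reconnect /= (proj2_sig s) kE; move: k E;
  by case: (kind d.1) => // _; case: (proj1_sig s _) => //= _; rewrite ?ccwK ?cwK.
Qed.

Lemma state_adj_sym (D : diagram) (s : state D) :
  is_classical D -> symmetric (state_adj s).
Proof.
move=> /(@reconnectK _ s) rK d d'; rewrite /state_adj.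
by congr (_ || _); apply/eqP/eqP => ->; rewrite ?other_endK ?rK.
Qed.

Lemma iso_cycles (D E : diagram) (b : bool) :
  diagram_iso D E -> is_classical D ->
  cycles (const_state D b) = cycles (const_state E b).
Proof.
move=> iso cl; have clE := proj1 (iso_classical iso) cl.
have [f [g [fK gK fo [fcc fc] fk]]] := iso_darts iso.
rewrite /cycles (proj1 iso); congr (_ + _)%N; apply/esym.
apply: (@n_comp_bij _ _ f g) => //; try exact/connect_sym_of_sym/state_adj_sym.
move=> d d'; rewrite /state_adj /reconnect /= fk -fo.
by case: ifP => _; rewrite -?fcc -?fc !(inj_eq (can_inj fK)).
Qed.

Lemma iso_turaev_genus (D E : diagram) :
  diagram_iso D E -> is_classical D ->
  diagram_turaev_genus D = diagram_turaev_genus E.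
Proof.
move=> iso cl; rewrite /diagram_turaev_genus !(iso_cycles _ iso cl).
by rewrite /crossings (iso_card iso).
Qed.

(** Nothing is erased: no passage is skipped and no component becomes crossing-free. *)
Lemma tilde_iso (D : diagram) : is_classical D -> diagram_iso (tilde D) D.
Proof.
move=> cl; set A := [pred x : passage D | kind x == Virtual].
have kA x : kept A x by rewrite /kept /= !cl.
split.
  rewrite /= (_ : [set C in _ | _] = set0) ?cards0 ?addn0 //.
  apply/setP => C; rewrite !inE; apply/negP => /andP[/imsetP[x _ ->]].
  by move/forall_inP/(_ x (porbit_id _ _)); rewrite kA.
exists val; split=> //.
  by exists (fun x => exist _ x (kA x)) => x //; apply: val_inj.
move=> x; rewrite permE /= /kept_next (_ : erased_run _ _ = 0%N) //.
by rewrite /erased_run; case: (fingraph.orbit _ _) => //= y s; rewrite kA.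
Qed.

(** * Homology mod 2 *)

Lemma connected_const (D : diagram) (T : eqType) (F : passage D -> T) :
  connected D -> (forall x, F (mate x) = F x) -> (forall x, F (next D x) = F x) ->
  forall x y, F x = F y.
Proof.
move=> cD Fm Fn x y; apply/esym/eqP.
have := n_comp1_connect (@atom_adj_sym D) cD (inl x) (inl y).
move/(@closed_connect _ _
  [pred a : atom D | if a is inl z then F z == F x else true]).
rewrite !inE eqxx => <- // [z|i] [w|j] //= /or3P[]/eqP->;
  by rewrite !inE ?Fm ?Fn.
Qed.

(** A crossing-free component is an isolated atom, so a connected diagram has none or is a single
    such circle. The boolean is read as 0 or 1. *)
Lemma connected_circles (D : diagram) :
  connected D -> circles D = (#|passage D| == 0)%N.
Proof.
move=> cD; have cc := n_comp1_connect (@atom_adj_sym D) cD.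
case: (pickP [pred x : passage D | true]) => [x _|P0].
  rewrite (_ : _ == _ = false); last first.
    by apply/negbTE; rewrite -lt0n; apply/card_gt0P; exists x.
  case Ec: (circles D) => [|n] //=.
  have := cc (inl x) (inr (cast_ord (esym Ec) ord0)).
  by move/(@closed_connect _ _ [pred a : atom D | if a is inl z then true else false])
    => /(_ (ltac:(by case=> [?|?] [?|?]))).
have P0' : #|passage D| = 0%N by apply: eq_card0 => x; have := P0 x.
rewrite P0' eqxx; apply/eqP; rewrite eqn_leq; apply/andP; split.
  rewrite leqNgt; apply/negP => lt1.
  have := cc (inr (Ordinal (ltnW lt1))) (inr (Ordinal lt1)).
  move/(@closed_connect _ _ [pred a : atom D | a == inr (Ordinal (ltnW lt1))]).
  rewrite !inE eqxx => /(_ (ltac:(by case=> [?|?] [?|?]))).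
  by move/esym/eqP => [].
rewrite lt0n; apply/eqP => c0.
have := max_card (predI (fingraph.roots (@atom_adj D)) predT).
by rewrite [X in (X <= _)%N]cD card_sum P0' card_ord c0.
Qed.

(** [mate] exchanges the two values of [side], so each double point has exactly one passage with
    [side] true, and the halving in [crossings] is exact. *)
Lemma card_sides (D : diagram) :
  #|passage D| = #|[pred x : passage D | side x]|.*2.
Proof.
rewrite -(cardC [pred x : passage D | side x]) -addnn; congr (_ + _)%N.
rewrite -(card_image (can_inj (@mateK D)) [pred x | side x]).
apply: eq_card => x; rewrite !inE -{2}[x]mateK (mem_image (can_inj (@mateK D))).
by rewrite inE side_mate.
Qed.

Lemma card_crossings (D : diagram) :
  crossings D = #|[pred x : passage D | side x]|.
Proof. by rewrite /crossings card_sides doubleK. Qed.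

Lemma card_passage (D : diagram) : #|passage D| = (crossings D).*2.
Proof. by rewrite card_crossings card_sides. Qed.

(** Faces are numbered through the roots of their [face]-cycles, in order to index matrix rows. *)
Lemma face_index (D : diagram) :
  exists idx : dart D -> 'I_(fcard (@face D) predT),
    (forall d, idx (face d) = idx d) /\ (forall i, exists d, idx d = i).
Proof.
have sym := fconnect_sym (@face_inj D).
have mem d : froot (@face D) d \in predI (froots (@face D)) predT.
  by rewrite !inE (roots_root sym).
exists (fun d => enum_rank_in (mem d) (froot (@face D) d)); split.
  move=> d; apply: enum_val_inj; rewrite !enum_rankK_in //.
  by apply/esym/(fingraph.rootP sym)/fconnect1.
move=> i; exists (enum_val i); apply: enum_val_inj; rewrite enum_rankK_in //.
by have := enum_valP i; rewrite !inE andbT => /eqP.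
Qed.

Lemma vertex_index (D : diagram) :
  exists vtx : passage D -> 'I_(crossings D),
    (forall x, vtx (mate x) = vtx x) /\ (forall i, exists x, vtx x = i).
Proof.
rewrite card_crossings; set S := [pred x | _].
pose rep (x : passage D) := if side x then x else mate x.
have mem x : rep x \in S.
  by rewrite inE /rep; case E: (side x); rewrite ?side_mate E.
exists (fun x => enum_rank_in (mem x) (rep x)); split.
  move=> x; apply: enum_val_inj; rewrite !enum_rankK_in //.
  by rewrite /rep side_mate mateK; case: (side x).
move=> i; exists (enum_val i); apply: enum_val_inj; rewrite enum_rankK_in //.
by have := enum_valP i; rewrite /rep inE => ->.
Qed.

Lemma F2_addxx (x : 'F_2) : x + x = 0.
Proof. by apply/val_inj; case: x => [[|[|]]]. Qed.

Lemma sum_delta (R : pzRingType) (I : finType) (v : I -> R) (k : I) :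
  \sum_i v i * (k == i)%:R = v k.
Proof.
rewrite (bigD1 k) //= eqxx mulr1 big1 ?addr0 // => i; rewrite eq_sym => /negbTE ->.
by rewrite mulr0.
Qed.

(** The left kernel lies in the span of the all-ones row, so its dimension is at most one. *)
Lemma rank_of_const_ker (K : fieldType) (m n : nat) (A : 'M[K]_(m, n)) :
  (forall v : 'rV_m, v *m A = 0 -> forall i j, v 0 i = v 0 j) ->
  (m <= (\rank A).+1)%N.
Proof.
move=> kA; suff : (\rank (kermx A) <= 1)%N by rewrite mxrank_ker; lia.
case: m A kA => [|m] A kA; first by rewrite (leq_trans (rank_leq_row _)).
apply: leq_trans (rank_leq_row (const_mx 1 : 'rV[K]_m.+1)).
apply/mxrankS/row_subP => i; have := kA (row i (kermx A)).
have : row i (kermx A) *m A = 0 by rewrite -row_mul mulmx_ker row0.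
move: (row i _) => v vA /(_ vA) cv; apply/submxP; exists (v 0 0)%:M; apply/rowP => j.
by rewrite mul_scalar_mx !mxE mulr1; apply: cv.
Qed.

(* Mod 2, [faceM] sends a region to its boundary edges, [edgeM] an edge to its
  ends; an edge is indexed by the passage it leaves. *)
Section Cellular.
Variables (D : diagram).
Hypothesis cD : connected D.
Variable idx : dart D -> 'I_(fcard (@face D) predT).
Hypothesis idx_face : forall d, idx (face d) = idx d.
Hypothesis idx_surj : forall i, exists d, idx d = i.
Variable vtx : passage D -> 'I_(crossings D).
Hypothesis vtx_mate : forall x, vtx (mate x) = vtx x.
Hypothesis vtx_surj : forall i, exists x, vtx x = i.

Let edge (j : 'I_#|passage D|) : dart D := (enum_val j, true).

Definition faceM : 'M['F_2]_(fcard (@face D) predT, #|passage D|) :=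
  \matrix_(i, j) ((idx (edge j) == i)%:R + (idx (other_end (edge j)) == i)%:R).

Definition edgeM : 'M['F_2]_(#|passage D|, crossings D) :=
  \matrix_(j, k) ((vtx (enum_val j) == k)%:R + (vtx (next D (enum_val j)) == k)%:R).

Lemma mul_faceM (v : 'rV_(fcard (@face D) predT)) j :
  (v *m faceM) 0 j = v 0 (idx (edge j)) + v 0 (idx (other_end (edge j))).
Proof.
rewrite mxE; under eq_bigr do rewrite mxE mulrDr.
by rewrite big_split /= !sum_delta.
Qed.

Lemma sum_passage (F : passage D -> 'F_2) :
  \sum_(j < #|passage D|) F (enum_val j) = \sum_x F x.
Proof. by rewrite -big_enum_val. Qed.

Lemma sum_next (F : passage D -> 'F_2) : \sum_x F (next D x) = \sum_x F x.
Proof. by rewrite [RHS](reindex_inj (@perm_inj _ (next D))). Qed.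

Lemma sum_mate (F : passage D -> 'F_2) : \sum_x F (mate x) = \sum_x F x.
Proof. by rewrite [RHS](reindex_inj (can_inj (@mateK D))). Qed.

(** Boundary of a boundary: regrouped by passages, the sum collects at each passage the four corners
    of its double point, and the two passages there contribute equally. *)
Lemma faceM_edgeM : faceM *m edgeM = 0.
Proof.
apply/matrixP => i k; rewrite !mxE.
pose g d : 'F_2 := (idx d == i)%:R; pose w y : 'F_2 := (vtx y == k)%:R.
have gc d : g (other_end d) = g (cw d) by rewrite /g -face_other_end idx_face.
(* [h x] counts the sides in face [i] of the edge leaving [x], and [h'] below those of the edge
   entering [x]; reindexing by [next] gathers both at [x]. *)
pose h x := g (x, true) + g (cw (x, true)).
rewrite (eq_bigr (fun j => h (enum_val j) * w (enum_val j)
    + h (enum_val j) * w (next D (enum_val j)))); last first.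
  by move=> j _; rewrite !mxE -mulrDr -/(w _) -/(w _) -/(g _) -/(g _) gc.
rewrite (sum_passage (fun x => h x * w x + h x * w (next D x))) big_split /=.
pose h' x := g (cw (x, false)) + g (x, false).
have hn x : h x = h' (next D x).
  rewrite /h /h' -!gc /other_end /= permK addrC; congr (_ + _).
rewrite [X in _ + X](eq_bigr (fun x => h' (next D x) * w (next D x))); last first.
  by move=> x _; rewrite hn.
rewrite (sum_next (fun x => h' x * w x)) -big_split /=.
pose u x := g (x, true) + g (x, false).
rewrite (eq_bigr (fun x => u x * w x + u (mate x) * w (mate x))); last first.
  move=> x _; rewrite [w (mate x)]/w vtx_mate -/(w x) -!mulrDl; congr (_ * _).
  rewrite /h /h' /u /cw /=; case: (side x) => /=; ring.
by rewrite big_split /= (sum_mate (fun x => u x * w x)) F2_addxx.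
Qed.

(** Each passage is the start of one edge and the end of one edge. *)
Lemma edges_edgeM : const_mx 1 *m edgeM = 0 :> 'rV_(crossings D).
Proof.
apply/rowP => k; rewrite !mxE; pose w y : 'F_2 := (vtx y == k)%:R.
under eq_bigr do rewrite !mxE mul1r.
rewrite (sum_passage (fun x => w x + w (next D x))) big_split /=.
by rewrite sum_next F2_addxx.
Qed.

(** A set of faces with empty boundary looks the same across every edge, hence at all corners of a
    double point and along each strand; connectedness makes it constant. *)
Lemma rank_faceM : (fcard (@face D) predT <= (\rank faceM).+1)%N.
Proof.
apply: rank_of_const_ker => v v0.
pose f d := v 0 (idx d).
have fo x : f (other_end (x, true)) = f (x, true).
  have := mul_faceM v (enum_rank x); rewrite v0 mxE /edge enum_rankK => /esym E.
  by rewrite -[LHS]addr0 -E /f addrCA F2_addxx addr0.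
have foe d : f (other_end d) = f d.
  case: d => x [] //; rewrite -{2}[(x, false)]other_endK.
  by rewrite {2}/other_end /= -fo /= /other_end /= permKV.
have fc d : f (cw d) = f d by rewrite -face_other_end /f idx_face -/(f _) foe.
have ft x b : f (x, b) = f (x, true).
  by case: b => //; rewrite -[RHS]fc -[RHS]fc cw_cw.
suff C : forall x y, f (x, true) = f (y, true).
  move=> i j; have [[x b] <-] := idx_surj i; have [[y b'] <-] := idx_surj j.
  by rewrite -!/(f _) ft [RHS]ft.
apply: connected_const => // x; first by rewrite -[RHS]fc /cw /= ft.
by rewrite -[RHS]fo /= ft.
Qed.

(** Dually, a function on the vertices with zero coboundary agrees at both ends of every edge. *)
Lemma rank_edgeM : (crossings D <= (\rank edgeM).+1)%N.
Proof.
rewrite -mxrank_tr; apply: rank_of_const_ker => v v0.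
suff C : forall x y, v 0 (vtx x) = v 0 (vtx y).
  by move=> i j; have [x <-] := vtx_surj i; have [y <-] := vtx_surj j.
apply: connected_const => // x; first by rewrite vtx_mate.
have /rowP/(_ (enum_rank x)) := v0; rewrite !mxE.
under eq_bigr do rewrite !mxE enum_rankK mulrDr.
rewrite big_split /= !sum_delta => E.
by rewrite -[LHS]addr0 -E addrCA F2_addxx addr0.
Qed.

Lemma euler_bound : (fcard (@face D) predT + crossings D <= #|passage D| + 2)%N.
Proof.
have := mulmx0_rank_max faceM_edgeM; have := rank_faceM; have := rank_edgeM; lia.
Qed.

Lemma face_potential :
  (fcard (@face D) predT + crossings D)%N = (#|passage D| + 2)%N ->
  exists v : 'rV['F_2]_(fcard (@face D) predT),
    forall d, v 0 (idx (other_end d)) = v 0 (idx d) + 1.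
Proof.
move=> eul.
have sub : (faceM <= kermx edgeM)%MS by apply/sub_kermxP/faceM_edgeM.
(* Equality in the Euler bound makes both rank bounds sharp, so the complex is exact at the
   edges. *)
have eqs : (faceM == kermx edgeM)%MS.
  rewrite -(mxrank_leqif_eq sub) mxrank_ker.
  have := mulmx0_rank_max faceM_edgeM; have := rank_faceM; have := rank_edgeM; lia.
have : ((const_mx 1 : 'rV_#|passage D|) <= faceM)%MS.
  by rewrite (eqmxP eqs); apply/sub_kermxP/edges_edgeM.
case/submxP=> v vE.
exists v.
have vo x : v 0 (idx (other_end (x, true))) = v 0 (idx (x, true)) + 1.
  have := mul_faceM v (enum_rank x); rewrite -vE mxE /edge enum_rankK => ->.
  by rewrite addrA F2_addxx add0r.
case=> x [] //; have := vo ((next D)^-1 x)%g.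
rewrite /other_end /= permKV => ->; by rewrite -addrA F2_addxx addr0.
Qed.

End Cellular.

Lemma planar_checkerboard (D : diagram) :
  connected D -> planar D -> exists col : dart D -> bool, checkerboard_coloring col.
Proof.
move=> cD; rewrite /planar /boundaries (connected_circles cD) [components D]cD => eul.
have [P0|/negbTE P0] := eqVneq #|passage D| 0%N.
  (* A single crossing-free circle has no darts to color. *)
  by exists xpredT; split=> -[x b]; have := card0_eq P0 x; rewrite inE.
have [idx [idx_face idx_surj]] := face_index D.
have [vtx [vtx_mate vtx_surj]] := vertex_index D.
have /(face_potential cD idx_face idx_surj vtx_mate vtx_surj)[v vE] :
    (fcard (@face D) predT + crossings D)%N = (#|passage D| + 2)%N.
  by move: eul; rewrite P0 /ribbon_euler /=; lia.
exists (fun d => v 0 (idx d) == 1); split=> d; first by rewrite idx_face.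
by rewrite vE; move: (v 0 _) => -[[|[|]]].
Qed.

(** * Genus of the closed surface *)

(** [odd_perm] is defined by counting [porbits], whereas faces are counted by [fcard]. *)
Lemma card_porbits (T : finType) (s : {perm T}) : #|porbits s| = fcard s predT.
Proof.
have sym := fconnect_sym (@perm_inj _ s).
have pc x y : (y \in porbit s x) = fconnect s x y.
  apply/porbitP/idP => [[i ->]|/iter_findex <-].
    by rewrite permX fconnect_iter.
  by exists (findex s x y); rewrite permX.
have pE x y : (porbit s x == porbit s y) = fconnect s x y.
  by rewrite eq_porbit_mem pc sym.
have inj : {in predI (froots s) predT &, injective (porbit s)}.
  move=> x y; rewrite !inE !andbT => /eqP rx /eqP ry /eqP.
  by rewrite pE -(root_connect sym) rx ry => /eqP.
rewrite /n_comp_mem -(card_in_imset inj).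
apply: eq_card => C; apply/imsetP/imsetP => [] [x _ ->]; last by exists x.
exists (froot s x); first by rewrite !inE andbT (roots_root sym).
by apply/eqP; rewrite pE connect_root.
Qed.

Lemma odd_perm_fcard (T : finType) (f : T -> T) (fI : injective f) :
  odd_perm (perm fI) = odd #|T| (+) odd (fcard f predT).
Proof.
rewrite /odd_perm card_porbits; congr (_ (+) odd _).
exact/eq_fcard/permE.
Qed.

Lemma fcard_uniform (T : finType) (f : T -> T) (n : nat) :
  injective f -> (forall x, fcycle f (traject f x n) && uniq (traject f x n)) ->
  (0 < n)%N -> (fcard f predT * n)%N = #|T|.
Proof.
move=> fI fn n0; apply: fcard_order_set => //; apply/subsetP => x _.
have /andP[cy un] := fn x; rewrite inE -(size_traject f x n); apply/eqP.
by apply: (order_cycle cy un); case: n n0 {fn cy un} => //= n _; rewrite mem_head.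
Qed.

(** With V crossings there are 4V darts; [other_end] has 2V cycles and is even, [cw] has V cycles
    and the parity of V. Their product is [face], so comparing signs gives the claim. *)
Lemma odd_faces (D : diagram) : odd (fcard (@face D) predT) = odd (crossings D).
Proof.
have oI : injective (@other_end D) := can_inj (@other_endK D).
have wI : injective (@cw D) := can_inj (@cwK D).
have card_dart : #|dart D| = (crossings D * 4)%N.
  by rewrite card_prod card_bool card_passage; lia.
have fo : fcard (@other_end D) predT = (crossings D * 2)%N.
  suff : (fcard (@other_end D) predT * 2)%N = #|dart D| by rewrite card_dart; lia.
  apply: fcard_uniform => // d; rewrite /= other_endK !eqxx /= inE andbT.
  by case: d => x [] ; rewrite /other_end /= xpair_eqE andbF.
have fw : fcard (@cw D) predT = crossings D.
  suff : (fcard (@cw D) predT * 4)%N = #|dart D| by rewrite card_dart; lia.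
  apply: fcard_uniform => // -[x b]; rewrite /= !cw_cw !eqxx /= !inE.
  rewrite /cw /= !xpair_eqE !negbK !eqxx /= !(eq_sym _ (mate x)).
  rewrite (negbTE (mate_neq x)) /=.
  by case: b; case: (side x).
have E : (perm oI * perm wI)%g = perm (@face_inj D).
  by apply/permP => d; rewrite permM !permE.
have := congr1 (@odd_perm _) E; rewrite odd_permM !odd_perm_fcard fo fw card_dart.
by rewrite !oddM !andbF /= => ->.
Qed.

(** The Euler characteristic of the capped surface is at most 2 by [euler_bound] and even by
    [odd_faces]. *)
Lemma closed_euler (D : diagram) : connected D ->
  exists h : nat, ribbon_euler D + (boundaries D)%:Z = 2%:Z - h%:Z *+ 2.
Proof.
move=> cD; rewrite /boundaries (connected_circles cD) /ribbon_euler.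
have [P0|/negbTE P0] := eqVneq #|passage D| 0%N.
  exists 0%N; rewrite /crossings P0 /=.
  suff -> : fcard (@face D) predT = 0%N by [].
  by apply/eqP; rewrite -leqn0 (leq_trans (max_card _)) // card_prod P0.
have [idx [idx_face idx_surj]] := face_index D.
have [vtx [vtx_mate vtx_surj]] := vertex_index D.
have := euler_bound cD idx_face idx_surj vtx_mate vtx_surj.
have := odd_faces D; rewrite card_passage.
move: (fcard _ _) (crossings D) => F V /= odF bd.
(* There are 2V edges, so the Euler characteristic is F - V; by [bd] the natural subtraction is not
   truncated. *)
exists (((V + 2 - F))./2)%N.
have := odd_double_half (V + 2 - F); rewrite oddB; last by lia.
by rewrite oddD odF addbF addbb; lia.
Qed.

(** * Closings of the ribbon surface and the minimal genus *)

Lemma connected_atom (D : diagram) : connected D -> exists a : atom D, true.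
Proof.
move=> cD; have /card_gt0P[a _] : (0 < #|predI (fingraph.roots (@atom_adj D)) predT|)%N.
  by rewrite [X in (_ < X)%N]cD.
by exists a.
Qed.

Lemma glue_adj_sym (D : diagram) (piece : finType) (dp : dart D -> piece)
    (cp : 'I_(circles D) * bool -> piece) : symmetric (glue_adj dp cp).
Proof. by case=> [[x|i]|p] [[y|j]|q] //; apply: (atom_adj_sym (inl x) (inl y)). Qed.

(** A piece meeting no boundary circle would be isolated in the gluing graph, which is connected and
    contains an atom; so boundary circles map onto the pieces. *)
Lemma card_piece_le (D : diagram) (c : closing D) :
  connected D -> (#|piece c| <= boundaries D)%N.
Proof.
move=> cD; have [a0 _] := connected_atom cD.
have sym := fconnect_sym (@face_inj D).
pose A := @dart_piece D c @: predI (froots (@face D)) predT.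
pose B := @circle_piece D c @: predT.
have sub : [set: piece c] \subset A :|: B.
  apply/subsetP => p _; rewrite -[_ \in _]negbK; apply/negP => pN.
  have glue0 a : glue_adj (@dart_piece D c) (@circle_piece D c) (inr p) (inl a) = false.
    apply/negbTE; move: pN; apply: contra.
    case: a => [x|i] /= H; rewrite inE; apply/orP; [left|right].
      have {H} [d <-] : exists d, dart_piece c d = p.
        by case/orP: H => /eqP <-; eexists.
      apply/imsetP; exists (froot (@face D) d).
        by rewrite !inE andbT (roots_root sym).
      apply/eqP.
      rewrite -(fconnect_invariant (k := @dart_piece D c) _ (connect_root _ d)) //.
      by move=> e /=; rewrite dart_piece_face eqxx.
    by case/orP: H => /eqP <-; apply: imset_f.
  have := n_comp1_connect (@glue_adj_sym _ _ _ _) (closing_connected c) (inr p) (inl a0).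
  move/(@closed_connect _ _ [pred z | z == inr p]); rewrite !inE eqxx.
  suff H : closed (glue_adj (@dart_piece D c) (@circle_piece D c)) [pred z | z == inr p].
    by move/(_ H).
  move=> z w zw; rewrite !inE; apply/eqP/eqP => E; move: zw; rewrite E.
    by case: w => // a; rewrite glue0.
  by rewrite glue_adj_sym; case: z => // a; rewrite glue0.
rewrite -cardsT (leq_trans (subset_leq_card sub)) // (leq_trans (leq_card_setU _ _)) //.
rewrite /boundaries leq_add // ?leq_imset_card //.
by rewrite (leq_trans (leq_imset_card _ _)) // card_prod card_ord card_bool muln2.
Qed.

(** The pieces are disks, one for each boundary circle, including both sides of each crossing-free
    component. *)
Lemma capped_closing (D : diagram) : connected D ->
  exists c : closing D, closing_euler c = ribbon_euler D + (boundaries D)%:Z.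
Proof.
move=> cD; have [a0 _] := connected_atom cD.
have [idx [idx_face idx_surj]] := face_index D.
pose bd : finType := ('I_(fcard (@face D) predT) + 'I_(circles D) * bool)%type.
pose dp d : bd := inl (idx d).
pose cp q : bd := inr q.
have dpf d : dp (face d) = dp d by rewrite /dp idx_face.
have gs := @glue_adj_sym D bd dp cp.
have catom a : connect (glue_adj dp cp) (inl a0) (inl a).
  have := n_comp1_connect (@atom_adj_sym D) cD a0 a.
  move/(@closed_connect _ _ [pred a | connect (glue_adj dp cp) (inl a0) (inl a)]).
  rewrite !inE connect0 => <- // z w zw; rewrite !inE.
  have zw' : glue_adj dp cp (inl z) (inl w) by case: z w zw => [?|?] [?|?].
  exact: (same_connect1r (connect_sym_of_sym gs) zw').
have cc : n_comp (glue_adj dp cp) predT = 1%N.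
  apply: (@connect_n_comp1 _ _ (inl a0) gs) => -[a|[i|[i b]]] //.
    have [[x b] <-] := idx_surj i; apply: connect_trans (catom (inl x)) _.
    by apply: connect1 => /=; case: b; rewrite /dp eqxx ?orbT.
  apply: connect_trans (catom (inr i)) _.
  by apply: connect1 => /=; case: b; rewrite /cp eqxx ?orbT.
exists (Closing (fun=> 0%N) dpf cc); rewrite /closing_euler /= sumr_const.
rewrite (_ : #|_| = boundaries D); first by rewrite -mulr_natr natz; lia.
by rewrite card_sum card_prod !card_ord card_bool muln2.
Qed.

(** Each piece adds at most 2, and there are at most as many pieces as boundary circles, so capping
    by disks is optimal. *)
Lemma closing_euler_le (D : diagram) (c : closing D) : connected D ->
  closing_euler c <= ribbon_euler D + (boundaries D)%:Z.
Proof.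
move=> cD; have := card_piece_le c cD; rewrite /closing_euler.
have : \sum_(p : piece c) (2%:Z - (piece_genus p)%:Z *+ 2) <= \sum_(p : piece c) 2%:Z.
  by apply: ler_sum => p _; lia.
have mul2 (n : nat) : 2%:Z *+ n = (n + n)%N%:Z by rewrite -mulr_natr natz; lia.
rewrite sumr_const mul2 => le_sum le_card; rewrite lerBlDr -[leRHS]addrA lerD2l.
by apply: (le_trans le_sum); rewrite -PoszD lez_nat leq_add.
Qed.

Lemma supporting_genus_connected (D : diagram) (h : nat) :
  connected D -> ribbon_euler D + (boundaries D)%:Z = 2%:Z - h%:Z *+ 2 ->
  supporting_genus D h.
Proof.
move=> cD eul; split.
  by have [c cE] := capped_closing cD; exists c; rewrite cE.
move=> n [c cE]; have := closing_euler_le c cD; rewrite cE eul leEnat; lia.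
Qed.

(** * The alternating diagram *)

Section Alternating.
Variables (D : diagram) (col : dart D -> bool).
Hypotheses (clD : is_classical D) (colD : checkerboard_coloring col).

Lemma col_cw d : col (cw d) = ~~ col d.
Proof. by case: colD => cf co; rewrite -face_other_end cf co. Qed.

Lemma col_ccw d : col (ccw d) = ~~ col d.
Proof. by rewrite -[in RHS](ccwK d) col_cw negbK. Qed.

Lemma col_reconnect (s : state D) d : col (reconnect s d) = ~~ col d.
Proof. by rewrite /reconnect; case: ifP; rewrite ?col_cw ?col_ccw. Qed.

(** Corners starting at the over-strand are the swept ones, whose color [incidence] tests; those
    starting at the under-strand have the other color. *)
Lemma incidenceE d : (incidence col d.1 == 1) = (col d == (kind d.1 == Over)).
Proof.
case: d => x b /=; have -> : col (x, b) = col (x, true).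
  by case: b => //; apply: coloring_opposite.
rewrite /incidence /over_passage; have := clD x.
case: (kind x) => //= _; first by case: (col _).
suff -> : col (mate x, true) = ~~ col (x, true) by case: (col _).
rewrite -(coloring_opposite (mate x) colD) -col_cw /cw /=.
by case: (side x); rewrite // (coloring_opposite _ colD).
Qed.

(* Reversing an arrow but not its sign turns the cyclic order at the crossing
  around. *)
Lemma cw_alt (d : dart D) : @cw (alt col) d = reconnect (const_state D (~~ col d)) d.
Proof.
rewrite /reconnect /=.
have := incidenceE d.
have im : incidence col (mate d.1) = incidence col d.1.
  rewrite /incidence /over_passage kind_mate mateK.
  by have := clD d.1; case: (kind d.1).
rewrite /cw /ccw /= /or_side /or_kind /= im /crossing_sign orbb.
rewrite {1 2}/incidence; have := clD d.1.
by case: (col (over_passage _, _)); case: (kind d.1) => //= _;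
  case: (col d) => //= _; rewrite ?addbT ?addbF ?addbK //; case: d.2; case: (side _).
Qed.

(** [other_end] changes the color, which cancels the negation in [cw_alt]: the walk follows the
    state named by the color on its left. *)
Lemma face_alt (d : dart D) :
  @face (alt col) d = reconnect (const_state D (col d)) (other_end d).
Proof. by rewrite /face cw_alt (proj2 colD) negbK. Qed.

(** On the darts of color [b], [face] is [other_end] followed by the reconnection of state [b], two
    involutions that change the color; [n_comp_two_involutions] applies. A crossing-free circle
    counts once in each state and twice as boundary. *)
Lemma alt_boundaries :
  boundaries (alt col)
  = (cycles (const_state D false) + cycles (const_state D true))%N.
Proof.
have [cf co] := colD.
have faces (b : bool) : n_comp (state_adj (const_state D b)) predT
    = fcard (@face (alt col)) [pred d | col d == b].
  apply: n_comp_two_involutions.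
  - exact: other_endK.
  - exact: reconnectK.
  - exact: (@face_inj (alt col)).
  - by move=> d /=; rewrite co; case: (col d); case: b.
  - by move=> d /=; rewrite col_reconnect; case: (col d); case: b.
  - by move=> d /=; rewrite face_alt col_reconnect co negbK.
  - by move=> d /= /eqP <-; rewrite face_alt.
rewrite /boundaries /cycles !faces /= (n_compC [pred d | col d == true]).
rewrite -addnn addnACA addnC; congr (_ + _ + _)%N.
by apply: eq_n_comp_r => d; rewrite !inE; case: (col d).
Qed.

End Alternating.

Lemma turaev_genus_alt (D : diagram) (col : dart D -> bool) :
  is_classical D -> connected D -> checkerboard_coloring col ->
  exists2 h : nat, supporting_genus (alt col) h & diagram_turaev_genus D = h%:R.
Proof.
move=> cl cD colD.
(* [alt] changes only [side] and [kind], on which [atom_adj] does not depend. *)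
have cA : connected (alt col) := cD.
have [h hE] := closed_euler cA.
exists h; first exact: supporting_genus_connected.
move: hE; rewrite (alt_boundaries cl colD) /diagram_turaev_genus.
have -> : ribbon_euler (alt col) = - (crossings D)%:Z.
  have -> : ribbon_euler (alt col) = ribbon_euler D by [].
  by rewrite /ribbon_euler card_passage; lia.
move: (cycles (const_state D false)) (cycles (const_state D true)) => s0 s1.
move: (crossings D) => c E.
have : c%:R + 2%:R - s0%:R - s1%:R = h%:R * 2%:R :> rat.
  apply/eqP; rewrite -!natrM -natrD !subr_eq -!natrD eqr_nat; lia.
by move=> ->; rewrite mulfK.
Qed.

(** * Existence of the minima and comparison of the two genera *)

(** Well-ordering for a predicate not assumed decidable, by excluded middle. *)
Lemma least_nat (P : nat -> Prop) (n : nat) :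
  P n -> exists2 m, is_minimum P m & (m <= n)%N.
Proof.
elim/ltn_ind: n => n IH Pn.
have [[m [mn Pm]]|no] := classic (exists m, (m < n)%N /\ P m).
  by have [k kmin km] := IH m mn Pm; exists k; rewrite // (leq_trans km) // ltnW.
exists n => //; split=> // k Pk; rewrite leEnat leqNgt; apply/negP => kn.
by apply: no; exists k.
Qed.

Lemma classical_equiv_virtual (D E : classical_diagram) :
  classical_equiv D E -> virtual_equiv D E.
Proof.
elim=> [A B m|A|A B _|A B C _ H1 _ H2].
- exact: Relation_Operators.rst_step.
- exact: Relation_Operators.rst_refl.
- exact: Relation_Operators.rst_sym.
- exact: Relation_Operators.rst_trans H1 H2.
Qed.

(** Colorings live on [tilde D], which is only isomorphic to [D]; planarity, connectedness and the
    Turaev genus are transported along this isomorphism. *)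
Lemma classical_alt_genus (D : classical_diagram) : connected D ->
  exists2 h : nat,
    exists2 col : dart (tilde D) -> bool,
      checkerboard_coloring col & supporting_genus (alt col) h
    & diagram_turaev_genus D = h%:R.
Proof.
move=> cD; have cl := cdiagram_classical (c := D).
have iso := tilde_iso cl; set G := tilde D in iso *.
have clG : is_classical G by apply/(iso_classical iso).
have cG : connected G by rewrite /connected (iso_components iso).
have plG : planar G by apply/(iso_planar iso)/vdiagram_planar.
have [col colG] := planar_checkerboard cG plG.
have [h sh hE] := turaev_genus_alt clG cG colG.
by exists h; [exists col|rewrite -(iso_turaev_genus iso clG)].
Qed.

Theorem lemma5p5 (L : classical_diagram) (nsL : non_split L) :
  exists (a : nat) (t : rat),
    [/\ alternating_genus L a, turaev_genus L t & a%:R <= t].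
Proof.
(* Turaev genera of connected classical diagrams are natural numbers, so their rational minimum is
   found in [nat]. *)
pose T h := exists D : classical_diagram,
  [/\ classical_equiv D L, connected D & diagram_turaev_genus D = h%:R].
(* [L] itself is connected, being non-split, so the set of values is nonempty. *)
have [h0 Th0] : exists h, T h.
  have LL : classical_equiv L L by apply: Relation_Operators.rst_refl.
  have [h _ hE] := classical_alt_genus (nsL L LL).
  by exists h, L; split=> //; apply: nsL.
have [h [[D [DL cD DE]] hmin] _] := least_nat Th0.
have [h' [col colD sh] h'E] := classical_alt_genus cD.
have hh : h' = h by apply/eqP; rewrite -(eqr_nat rat) -h'E DE.
rewrite {}hh {h'E} in sh.
pose A n := exists D : virtual_diagram, virtual_equiv D L /\
    exists col : dart (tilde D) -> bool,
      checkerboard_coloring col /\ supporting_genus (alt col) n.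
(* The diagram realizing the Turaev genus is also a competitor for the alternating genus, with the
   same value. *)
have Ah : A h.
  by exists D; split; [apply: classical_equiv_virtual|exists col].
have [a amin ah] := least_nat Ah.
exists a, h%:R; split; [exact: amin| |by rewrite ler_nat].
split; first by exists D; split.
move=> _ [E [EL cE ->]].
have [n _ nE] := classical_alt_genus cE; rewrite nE ler_nat.
by apply: hmin; exists E.
Qed.
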